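(* Let $X$ be an infinite-dimensional complex Banach space and let $T$ be a generalized Drazin invertible bounded linear operator on $X$ with generalized Drazin inverse $T^D$. Then $T$ has property $(Q)$ if and only if $T^D$ has property $(Q)$.
   Context: A bounded operator $T$ on $X$ is generalized Drazin invertible if there is a bounded operator $S$ on $X$ with $ST=TS$, $STS=S$ and $TST=T+U$ with $U$ quasinilpotent (equivalently, $0$ is not an accumulation point of $\sigma(T)$). Such $S$ is unique; it is called the generalized Drazin inverse of $T$ and denoted $T^D$. The quasinilpotent part of a bounded operator $S$ is $H_0(S)=\{x\in X:\lim_{n\to\infty}\|S^nx\|^{1/n}=0\}$. $T$ has property $(Q)$ if $H_0(\lambda I-T)$ is closed for every $\lambda\in\mathbb{C}$. *)

(* Defs.v *)
From HB Require Import structures.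
From mathcomp Require Import all_boot all_order all_algebra.
From mathcomp Require Import complex.
From mathcomp Require Import all_classical all_reals all_analysis.

Set Implicit Arguments.
Unset Strict Implicit.
Unset Printing Implicit Defensive.

Import Order.TTheory GRing.Theory Num.Theory.
Import numFieldNormedType.Exports.

Local Open Scope classical_set_scope.
Local Open Scope ring_scope.
Local Open Scope complex_scope.

Definition infinite_dimensional (K : numFieldType) (X : lmodType K) : Prop :=
  ~ exists (n : nat) (v : 'I_n -> X),
      forall x : X, exists c : 'I_n -> K, x = \sum_(i < n) c i *: v i.

Section Operators.
Context {R : realType} {X : completeNormedModType R[i]}.
Implicit Types S T U : {linear X -> X}.

(* For linear maps this is equivalent to continuity
   ([linear_bounded_continuous]) and to the existence of a global bound
   [`|T x| <= r * `|x|] ([linear_boundedP]). *)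
Definition bounded_operator T : Prop := bounded_near T (nbhs (0 : X)).

Definition scalar_sub (lambda : R[i]) T : {linear X -> X} :=
  (lambda \*: (idfun : {linear X -> X})) \- T.

Definition spectrum T : set R[i] :=
  [set lambda | ~ exists S, [/\ bounded_operator S,
     cancel S (scalar_sub lambda T) & cancel (scalar_sub lambda T) S]].

Definition quasinilpotent U : Prop :=
  bounded_operator U /\ spectrum U = [set 0].

Definition is_gDrazin_inverse T S : Prop :=
  [/\ bounded_operator S,
      S \o T =1 T \o S,
      S \o T \o S =1 S &
      exists U, quasinilpotent U /\ T \o S \o T =1 T \+ U].

(* The norm of [X] takes its values in [R[i]] (nonnegative reals), so
   [n.-root] is here the nonnegative real [n]-th root for [0 < n];
   [R[i]^o] carries the topology of the complex modulus. *)
Definition quasinilpotent_part S : set X :=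
  [set x | n.-root `|iter n S x| @[n --> \oo] --> (0 : R[i]^o)].

Definition property_Q T : Prop :=
  forall lambda : R[i], closed (quasinilpotent_part (scalar_sub lambda T)).

End Operators.

(* Main.v *)
Require Import Defs.
From HB Require Import structures.
From mathcomp Require Import all_boot all_order all_algebra.
From mathcomp Require Import complex separable cyclotomic cyclic ring lra.
From mathcomp Require Import all_classical all_reals all_analysis.

Import Order.TTheory GRing.Theory Num.Theory.
Import numFieldNormedType.Exports.

Local Open Scope classical_set_scope.
Local Open Scope ring_scope.
Local Open Scope complex_scope.

(** Write [S] for the generalized Drazin inverse of [T].  The idempotent
    [P = 1 - T S] commutes with [T] and [S] and splits [X] into [ker P], on
    which [T] and [S] are inverse to each other, and [ran P = ker S], on which
    [S] vanishes and [T] agrees with the quasinilpotent operator [- U], where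
    [U = T S T - T].  The two operators are then compared eigenvalue by
    eigenvalue.

    At 0, both quasinilpotent parts equal the closed subspace [ker S]
    ([quasinilpotent_part0], [quasinilpotent_part0D]): an invertible operator
    has trivial quasinilpotent part, and a quasinilpotent one has everything.

    At [l <> 0], the quasinilpotent part of [l - T] equals that of [l^-1 - S]
    ([quasinilpotent_part_inv]).  On [ran P] both operators are invertible, so
    neither contributes; on [ker P] one has
    [l^-1 - S = - l^-1 S (l - T)] with [S] bounded, invertible and commuting
    with [l - T], so that the iterates of the two operators are comparable up
    to geometric factors, which do not affect the quasinilpotent part.  Since
    [l |-> l^-1] permutes the nonzero scalars, the theorem follows.

    The analytic ingredient is that an operator whose spectrum is [{0}] is
    quasinilpotent at every vector ([quasinilpotent_partT]).  This is the
    spectral radius formula in the case of radius 0, obtained here without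
    vector-valued holomorphic functions, by Rickart's argument with roots of
    unity.  Let [G z = (1 - z U)^-1], which exists for every [z].  By
    compactness it is bounded on each disc, hence Lipschitz there.  The
    average of [G (w z)] over the [n]-th roots of unity [w] is the inverse of
    [1 - z^n U^n] ([root_average_inverse]), and it is Lipschitz in [z] with a
    constant independent of [n].  If [t^n U^n] tends to 0, the average at [t]
    is close to the identity for large [n], hence so is the average at [s] for
    [s] near [t], which forces [s^n U^n] to stay bounded
    ([power_bound_transfer]).  The admissible distance from [t] to [s] is
    uniform on bounded sets, so finitely many steps from [t = 0] reach any
    prescribed [t] ([quasinilpotent_power_decay]). *)

(** * Real-valued norms *)

(** Norms over [R[i]] are complex numbers, whose order is only partial; their
    real parts carry the same information and live in an ordered field. *)
Definition rnorm {R : realType} {V : normedZmodType R[i]} (x : V) : R :=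
  complex.Re `|x|.

Section RealNorm.
Context {R : realType}.

Lemma rnormE (V : normedZmodType R[i]) (x : V) : `|x| = (rnorm x)%:C.
Proof. by rewrite /rnorm RRe_real ?normr_real. Qed.

Lemma rnorm_le (V W : normedZmodType R[i]) (x : V) (y : W) (c : R) :
  (`|x| <= c%:C * `|y|) = (rnorm x <= c * rnorm y).
Proof. by rewrite !rnormE -rmorphM lecR. Qed.

Lemma rnorm_ge0 (V : normedZmodType R[i]) (x : V) : 0 <= rnorm x.
Proof. by have := normr_ge0 x; rewrite rnormE -[0]/(0%:C) lecR. Qed.

Lemma rnorm0 (V : normedZmodType R[i]) : rnorm (0 : V) = 0.
Proof. by rewrite /rnorm normr0. Qed.

Lemma rnorm_eq0 (V : normedZmodType R[i]) (x : V) : (rnorm x == 0) = (x == 0).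
Proof. by rewrite -(normr_eq0 x) rnormE -[0 in RHS]/(0%:C) (inj_eq (@complexI _)). Qed.

Lemma rnormN (V : normedZmodType R[i]) (x : V) : rnorm (- x) = rnorm x.
Proof. by rewrite /rnorm normrN. Qed.

Lemma rnormD (V : normedZmodType R[i]) (x y : V) :
  rnorm (x + y) <= rnorm x + rnorm y.
Proof. by rewrite -lecR rmorphD /= -!rnormE ler_normD. Qed.

Lemma rnormB (V : normedZmodType R[i]) (x y : V) :
  rnorm (x - y) <= rnorm x + rnorm y.
Proof. by rewrite -(rnormN _ y) rnormD. Qed.

Lemma rnorm_sum (V : normedZmodType R[i]) n (F : 'I_n -> V) :
  rnorm (\sum_(i < n) F i) <= \sum_(i < n) rnorm (F i).
Proof.
elim/big_ind2: _ => [|x a y b xa yb|//]; first by rewrite rnorm0.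
exact: le_trans (rnormD _ _ _) (lerD xa yb).
Qed.

Lemma rnormZ (V : normedModType R[i]) (a : R[i]) (x : V) :
  rnorm (a *: x) = rnorm a * rnorm x.
Proof. by apply: (@complexI R); rewrite rmorphM /= -!rnormE normrZ. Qed.

Lemma rnormM (a b : R[i]) : rnorm (a * b) = rnorm a * rnorm b.
Proof. by apply: (@complexI R); rewrite rmorphM /= -!rnormE normrM. Qed.

Lemma rnorm1 : rnorm (1 : R[i]) = 1.
Proof. by apply: (@complexI R); rewrite -rnormE normr1. Qed.

Lemma rnormX (a : R[i]) n : rnorm (a ^+ n) = rnorm a ^+ n.
Proof. by elim: n => [|n IH]; rewrite ?expr0 ?rnorm1// !exprS rnormM IH. Qed.

Lemma rnormV (a : R[i]) : rnorm a^-1 = (rnorm a)^-1.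
Proof. by apply: (@complexI R); rewrite fmorphV /= -!rnormE normfV. Qed.

Lemma rnorm_real (t : R) : 0 <= t -> rnorm t%:C = t.
Proof.
by move=> t0; apply: (@complexI R); rewrite -rnormE ger0_norm // -[0]/(0%:C) lecR.
Qed.

Lemma rnorm_imag : rnorm 'i%C = 1 :> R.
Proof.
by apply: (@complexI R); rewrite -rnormE normc_def /= expr0n expr1n add0r sqrtr1.
Qed.

Lemma rnorm_complexR (t : R) : rnorm t%:C = `|t|.
Proof.
have [t0|t0] := leP 0 t; first by rewrite rnorm_real ?ger0_norm.
by rewrite -rnormN -rmorphN rnorm_real ?ltr0_norm // oppr_ge0 ltW.
Qed.

Lemma rnorm_sqrt (z : R[i]) :
  rnorm z = Num.sqrt (complex.Re z ^+ 2 + complex.Im z ^+ 2).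
Proof. by rewrite /rnorm normc_def. Qed.

Lemma rnorm_ge_Re (z : R[i]) : `|complex.Re z| <= rnorm z.
Proof. by rewrite rnorm_sqrt -sqrtr_sqr ler_wsqrtr // lerDl sqr_ge0. Qed.

Lemma rnorm_ge_Im (z : R[i]) : `|complex.Im z| <= rnorm z.
Proof. by rewrite rnorm_sqrt -sqrtr_sqr ler_wsqrtr // lerDr sqr_ge0. Qed.

End RealNorm.

(** * Bounded operators and roots of unity *)

Section Bounded.
Context {R : realType} {X : normedModType R[i]}.
Implicit Types A B : {linear X -> X}.

Lemma bounded_rnormP A :
  bounded_near A (nbhs (0 : X)) <->
  exists2 c : R, 0 <= c & forall x, rnorm (A x) <= c * rnorm x.
Proof.
rewrite linear_boundedP; split.
  move=> [M [Mreal HM]].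
  exists (`|complex.Re M| + 1); first by rewrite addr_ge0.
  move=> x; rewrite -rnorm_le; apply: HM.
  by rewrite -(RRe_real Mreal) ltcR; apply: le_lt_trans (ler_norm _) _; rewrite ltrDl.
move=> [c c0 Hc]; exists c%:C; split; first by rewrite complex_real.
move=> r cr x; apply: le_trans (_ : c%:C * `|x| <= _); first by rewrite rnorm_le.
by apply: ler_wpM2r => //; apply: ltW.
Qed.

End Bounded.

Lemma exists_prim_root (F : closedFieldType) n :
  n%:R != 0 :> F -> exists w : F, n.-primitive_root w.
Proof.
move=> n_neq0; have n_gt0 : (0 < n)%N by case: n n_neq0 => //; rewrite eqxx.
have [r Dp] := closed_field_poly_normal ('X^n - 1 : {poly F}).
rewrite (monicP _) ?monicXnsubC // scale1r in Dp.
have rn1: all n.-unity_root r by apply/allP=> z; rewrite -root_prod_XsubC -Dp.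
have sz_r: (n < (size r).+1)%N.
  by rewrite -(size_prod_XsubC r id) -Dp size_XnsubC.
have [|z] := hasP (has_prim_root n_gt0 rn1 _ sz_r); last by exists z.
by rewrite -separable_prod_XsubC -Dp separable_Xn_sub_1.
Qed.

Lemma sum_prim_root_exp (F : fieldType) n (w : F) m :
  n.-primitive_root w -> ~~ (n %| m)%N -> \sum_(k < n) (w ^+ m) ^+ k = 0.
Proof.
move=> wn nm; have := subrX1 (w ^+ m) n.
rewrite -exprM mulnC exprM (prim_expr_order wn) expr1n subrr => /esym/eqP.
by rewrite mulf_eq0 subr_eq0 -(prim_order_dvd wn) (negPf nm) => /eqP.
Qed.

Lemma rnorm_prim_root_exp {R : realType} n (w : R[i]) k :
  n.-primitive_root w -> rnorm (w ^+ k) = 1.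
Proof.
move=> wn; have n0 := prim_order_gt0 wn.
have : rnorm w ^+ n = 1 by rewrite -rnormX (prim_expr_order wn) rnorm1.
move=> /eqP; rewrite pexpr_eq1 ?rnorm_ge0 // => /eqP w1.
by rewrite rnormX w1 expr1n.
Qed.

(** * Domination and the quasinilpotent part *)

Section QuasinilpotentPart.
Context {R : realType} {X : completeNormedModType R[i]}.
Implicit Types A B : {linear X -> X}.

Lemma quasinilpotent_partP A x :
  quasinilpotent_part A x <->
  forall e : R, 0 < e -> \forall n \near \oo, rnorm (iter n A x) <= e ^+ n.
Proof.
apply: (iff_trans (@cvgr0Pnorm_le R[i] R[i]^o nat \oo _ _)); split=> H e e0.
  have := H e%:C; rewrite -[0]/(0%:C) ltcR => /(_ e0) {}H.
  near=> n; have n0 : (0 < n)%N by near: n; exact: nbhs_infty_gt.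
  have : `|n.-root `|iter n A x| | <= e%:C by near: n.
  rewrite ger0_norm ?rootC_ge0 // => /(lerXn2r n).
  rewrite !nnegrE rootC_ge0 // normr_ge0 -[0]/(0%:C) lecR (ltW e0).
  by move=> /(_ isT isT); rewrite rootCK // rnormE -rmorphXn lecR.
have ereal : e \is Num.real by apply: gtr0_real.
move: e0; rewrite -(RRe_real ereal) -[0]/(0%:C) ltcR => e0.
have {}H := H _ e0.
near=> n; have n0 : (0 < n)%N by near: n; exact: nbhs_infty_gt.
rewrite ger0_norm ?rootC_ge0 //.
rewrite -(@ler_pXn2r _ n) ?nnegrE ?rootC_ge0 //; last by rewrite -[0]/(0%:C) lecR ltW.
by rewrite rootCK // rnormE -rmorphXn lecR; near: n.
Unshelve. all: by end_near. Qed.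

(** A geometric factor [g ^+ n] is harmless because the quasinilpotent part asks
    for decay faster than every geometric sequence, and a constant factor [k] is
    eventually below [2 ^+ n]. *)
Lemma quasinilpotent_part_dominated A x (f : nat -> X) (k g : R) :
  0 <= k -> 0 <= g ->
  (forall n, rnorm (f n) <= k * g ^+ n * rnorm (iter n A x)) ->
  quasinilpotent_part A x ->
  forall e : R, 0 < e -> \forall n \near \oo, rnorm (f n) <= e ^+ n.
Proof.
move=> k0 g0 fA /quasinilpotent_partP Ax e e0.
have g1 : 0 < 2 * (g + 1) by rewrite mulr_gt0 // ltr_wpDl.
have d0 : 0 < e / (2 * (g + 1)) by rewrite divr_gt0.
have {}Ax := Ax _ d0.
near=> n; apply: le_trans (fA n) _.
have gn : 0 <= g ^+ n by rewrite exprn_ge0.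
apply: (@le_trans _ _ (k * g ^+ n * (e / (2 * (g + 1))) ^+ n)).
  by apply: ler_wpM2l; [rewrite mulr_ge0|near: n].
have kn : k <= 2 ^+ n.
  apply: (@le_trans _ _ n%:R); last by rewrite -natrX ler_nat ltnW // ltn_expl.
  by near: n; exact: nbhs_infty_ger.
have -> : e ^+ n = 2 ^+ n * (g + 1) ^+ n * (e / (2 * (g + 1))) ^+ n.
  by rewrite -!exprMn mulrC mulfVK ?gt_eqF.
rewrite ler_wpM2r ?exprn_ge0 ?(ltW d0) //.
by apply: ler_pM => //; rewrite lerXn2r ?nnegrE ?addr_ge0 // lerDl.
Unshelve. all: by end_near. Qed.

(** The case of a constant sequence: a vector whose norm is below every [e ^+ n]
    is 0. *)
Lemma quasinilpotent_part_dominated0 A x (y : X) (k g : R) :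
  0 <= k -> 0 <= g ->
  (forall n, rnorm y <= k * g ^+ n * rnorm (iter n A x)) ->
  quasinilpotent_part A x -> y = 0.
Proof.
move=> k0 g0 yA Ax; apply/eqP; rewrite -rnorm_eq0 eq_le rnorm_ge0 andbT.
apply/ler_addgt0Pr => e e0; rewrite add0r.
(* Capping [e] at 1 makes the powers decrease, so that [d ^+ n.+1 <= e]. *)
pose d := Num.min e 1.
have d0 : 0 < d by rewrite lt_min e0 ltr01.
have de : d <= e by rewrite /d ge_min lexx.
have d1 : d <= 1 by rewrite /d ge_min lexx orbT.
have [N _ HN] := @quasinilpotent_part_dominated A x (fun=> y) k g k0 g0 yA Ax d d0.
apply: le_trans (HN N.+1 (leqnSn N)) _.
by apply: le_trans de; rewrite exprS ger_pMr // exprn_ile1 // ltW.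
Qed.

End QuasinilpotentPart.

(** * The resolvent and its averages over roots of unity *)

Section Resolvent.
Context {R : realType} {X : completeNormedModType R[i]}.
Variables (U : {linear X -> X}) (u : R).
Hypotheses (u_ge0 : 0 <= u) (Uu : forall x, rnorm (U x) <= u * rnorm x).

(** A perturbation argument in place of a Neumann series: only a lower bound is
    propagated, invertibility being known everywhere. *)
Lemma lower_bound_stable (c : R) (z z' : R[i]) :
  0 <= c -> (forall x, rnorm x <= c * rnorm (x - z *: U x)) ->
  c * u * rnorm (z' - z) <= 2^-1 ->
  forall x, rnorm x <= 2 * c * rnorm (x - z' *: U x).
Proof.
move=> c0 cz zz' x.
have -> : x - z' *: U x = (x - z *: U x) - (z' - z) *: U x.
  by rewrite scalerBl opprB addrA subrK.
set d := (z' - z) *: U x; set y := x - z *: U x.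
have dx : rnorm d <= rnorm (z' - z) * (u * rnorm x).
  by rewrite rnormZ; apply: ler_wpM2l => //; exact: rnorm_ge0.
have yd : rnorm y <= rnorm (y - d) + rnorm d by have := rnormD _ (y - d) d; rewrite subrK.
have xy : rnorm x <= c * rnorm y by exact: cz.
have cd : c * rnorm d <= 2^-1 * rnorm x.
  apply: le_trans (ler_wpM2l c0 dx) _.
  have -> : c * (rnorm (z' - z) * (u * rnorm x)) = c * u * rnorm (z' - z) * rnorm x.
    by ring.
  by rewrite ler_wpM2r // rnorm_ge0.
have := ler_wpM2l c0 yd; rewrite mulrDr => cy.
by lra.
Qed.

(** Local bounds become uniform by compactness.  The disc is enclosed in a
    square of [R * R], whose compactness comes from that of real segments. *)
Lemma lower_bound_disc (M : R) :
  (forall z : R[i], exists2 c : R, 0 <= c &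
     forall x, rnorm x <= c * rnorm (x - z *: U x)) ->
  exists2 c : R, 0 <= c &
    forall z, rnorm z <= M -> forall x, rnorm x <= c * rnorm (x - z *: U x).
Proof.
move=> H.
pose K : set (R * R) := `[- M, M]%classic `*` `[- M, M]%classic.
have cK : compact K by apply: compact_setX; exact: segment_compact.
move: cK => /compact_near_coveringP/(_ R +oo%R (fun c p =>
  forall x, rnorm x <= c * rnorm (x - (p.1 +i* p.2) *: U x)) _) [].
  move=> [a b] _ /=; have [c c0 cz] := H (a +i* b).
  (* [2 d] bounds [|z' - z|] on the ball, and [c u (2 d) <= 1/2]. *)
  pose d := (4 * (c * u + 1))^-1.
  have cu1 : 0 < c * u + 1 by rewrite ltr_wpDl // mulr_ge0.
  have d0 : 0 < d by rewrite invr_gt0 mulr_gt0.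
  exists (ball (a, b) d, [set c' | 2 * c <= c']).
    by split=> /=; [exact: nbhsx_ballx|apply: nbhs_pinfty_ge; rewrite num_real].
  move=> [[a' b'] c'] /= [[/= aa' bb'] cc'] x.
  apply: le_trans (_ : 2 * c * rnorm (x - (a' +i* b') *: U x) <= _); last first.
    by rewrite ler_wpM2r ?rnorm_ge0.
  apply: (@lower_bound_stable c (a +i* b)) => //.
  have zz : rnorm ((a' +i* b') - (a +i* b)) <= 2 * d.
    have -> : (a' +i* b') - (a +i* b) = (a' - a)%:C + 'i%C * (b' - b)%:C.
      by simpc.
    apply: le_trans (rnormD _ _ _) _.
    rewrite rnormM rnorm_imag mul1r !rnorm_complexR mulr_natl mulr2n.
    by rewrite lerD // distrC ltW.
  apply: (@le_trans _ _ ((c * u + 1) * (2 * d))).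
    by apply: ler_pM => //; rewrite ?rnorm_ge0 ?mulr_ge0 // lerDl.
  have -> // : (c * u + 1) * (2 * d) = 2^-1.
  by rewrite /d; field; rewrite gt_eqF.
move=> c0 [c0r Hc0].
have c1 : c0 < Num.max 0 (c0 + 1) by rewrite lt_max ltrDl ltr01 orbT.
exists (Num.max 0 (c0 + 1)); first by rewrite le_max lexx.
move=> [a b] zM x; apply: (Hc0 _ c1 (a, b)); split => /=.
  by rewrite in_itv /= -ler_norml; apply: le_trans (rnorm_ge_Re _) zM.
by rewrite in_itv /= -ler_norml; apply: le_trans (rnorm_ge_Im _) zM.
Qed.

Variable G : R[i] -> {linear X -> X}.
Hypothesis GK : forall z x, G z (x - z *: U x) = x.
Hypothesis KG : forall z x, G z x - z *: U (G z x) = x.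

Definition root_average n (w z : R[i]) (x : X) : X :=
  n%:R^-1 *: \sum_(k < n) G (w ^+ k * z) x.

(** Finite geometric series: [(1 - z U) \sum_(m < n) z^m U^m = 1 - z^n U^n]. *)
Lemma resolvent_geometric (z : R[i]) n x :
  G z (x - z ^+ n *: iter n U x) = \sum_(m < n) z ^+ m *: iter m U x.
Proof.
rewrite -[RHS](GK z); congr (G z _).
elim: n => [|n IH]; first by rewrite big_ord0 linear0 scaler0 subr0 expr0 scale1r subrr.
rewrite big_ord_recr /= linearD scalerDr opprD addrACA -IH (linearZ_LR U) scalerA -exprS.
by rewrite addrA subrK.
Qed.

(** Replacing [z] by [w^k z] leaves [z^n U^n] unchanged, so each resolvent in
    the average turns the argument into a geometric sum; averaging over [k]
    kills every power of [U] except the zeroth. *)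
Lemma root_average_inverse n (w z : R[i]) x : n.-primitive_root w ->
  root_average n w z (x - z ^+ n *: iter n U x) = x.
Proof.
move=> wn; have n0 := prim_order_gt0 wn.
rewrite /root_average.
under eq_bigr => k _.
  have -> : z ^+ n = (w ^+ k * z) ^+ n.
    by rewrite exprMn -exprM mulnC exprM (prim_expr_order wn) expr1n mul1r.
  rewrite resolvent_geometric.
  over.
rewrite exchange_big /=.
case: n n0 wn => // n _ wn.
rewrite big_ord_recl /= [X in _ + X]big1 => [|m _].
  rewrite addr0 (eq_bigr (fun=> x)) => [|k _]; last by rewrite expr0 scale1r.
  rewrite sumr_const card_ord -[x *+ _]scaler_nat scalerA mulVf ?scale1r ?pnatr_eq0 //.
under eq_bigr => k _ do rewrite exprMn -exprM mulnC exprM.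
rewrite -scaler_suml -mulr_suml sum_prim_root_exp ?mul0r ?scale0r //.
by rewrite /bump leq0n gtnNdvd // ltnS add1n; case: m.
Qed.

Variables (r c : R).
Hypotheses (c_ge0 : 0 <= c)
  (Gc : forall z, rnorm z <= r -> forall x, rnorm (G z x) <= c * rnorm x).

(** The resolvent identity [G z - G z' = (z - z') G z U G z']. *)
Lemma resolvent_lipschitz (z z' : R[i]) x : rnorm z <= r -> rnorm z' <= r ->
  rnorm (G z x - G z' x) <= rnorm (z - z') * (c ^+ 2 * u) * rnorm x.
Proof.
move=> zr zr'.
have -> : G z x - G z' x = G z ((z - z') *: U (G z' x)).
  rewrite -[LHS](GK z); congr (G z _).
  transitivity ((G z x - z *: U (G z x)) - (G z' x - z *: U (G z' x))).
    rewrite (linearB U) scalerBr !opprB -!addrA; congr (_ + _).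
    by rewrite [LHS]addrCA [RHS]addrCA [X in _ + X]addrC.
  rewrite KG -[in X in X - _](KG z' x) scalerBl opprB addrC.
  by rewrite subrKA.
apply: le_trans (Gc _ zr _) _.
rewrite rnormZ.
have vc : rnorm (U (G z' x)) <= u * (c * rnorm x).
  by apply: le_trans (Uu _) _; rewrite ler_wpM2l // Gc.
have -> : rnorm (z - z') * (c ^+ 2 * u) * rnorm x =
    c * (rnorm (z - z') * (u * (c * rnorm x))) by ring.
exact: (ler_wpM2l c_ge0 (ler_wpM2l (rnorm_ge0 _ (z - z')) vc)).
Qed.

Lemma root_average_lipschitz n (w z z' : R[i]) x : n.-primitive_root w ->
  rnorm z <= r -> rnorm z' <= r ->
  rnorm (root_average n w z x - root_average n w z' x) <=
    rnorm (z - z') * (c ^+ 2 * u) * rnorm x.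
Proof.
move=> wn zr zr'; have n0 := prim_order_gt0 wn.
have wk := fun k => rnorm_prim_root_exp n w k wn.
rewrite -scalerBr -sumrB rnormZ rnormV -(rmorph_nat (real_complex R)).
rewrite rnorm_real ?ler0n // ler_pdivrMl ?ltr0n //.
apply: le_trans (rnorm_sum _ _ _) _.
apply: le_trans (ler_sum _ (fun k _ => _ : _ <= rnorm (z - z') * (c ^+ 2 * u) * rnorm x)) _.
  move=> k _; apply: le_trans (resolvent_lipschitz _ _ _ _ _) _; rewrite ?rnormM ?wk ?mul1r //.
  by rewrite -mulrBr rnormM wk mul1r.
by rewrite sumr_const card_ord mulr_natl.
Qed.

Lemma root_average_bound n (w z : R[i]) x : n.-primitive_root w ->
  rnorm z <= r -> rnorm (root_average n w z x) <= c * rnorm x.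
Proof.
move=> wn zr; have n0 := prim_order_gt0 wn.
have wk := fun k => rnorm_prim_root_exp n w k wn.
rewrite rnormZ rnormV -(rmorph_nat (real_complex R)).
rewrite rnorm_real ?ler0n // ler_pdivrMl ?ltr0n //.
apply: le_trans (rnorm_sum _ _ _) _.
apply: le_trans (ler_sum _ (fun k _ => _ : _ <= c * rnorm x)) _.
  by move=> k _; apply: Gc; rewrite rnormM wk mul1r.
by rewrite sumr_const card_ord mulr_natl.
Qed.

Lemma root_averageB n (w z : R[i]) x y :
  root_average n w z (x - y) = root_average n w z x - root_average n w z y.
Proof.
rewrite /root_average -scalerBr -sumrB; congr (_ *: _).
by apply: eq_bigr => k _; rewrite linearB.
Qed.

(** With [x = (1 - s^n U^n) y], the average at [s] sends [x] to [y].  The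
    averages at [s] and [t] differ by at most 1/8 (Lipschitz bound), and the
    average at [t] is within 1/8 of the identity (smallness of [t^n U^n]).
    Hence [s^n U^n y = y - x] has norm at most a quarter of that of [x], and
    [|x| <= |y| + |y - x|] turns this into a bound by the norm of [y]. *)
Lemma power_bound_transfer n (t s e : R) : (0 < n)%N ->
  0 <= t <= r -> 0 <= s <= r -> `|s - t| * (c ^+ 2 * u) <= 8^-1 -> c * e <= 8^-1 ->
  (forall x, t ^+ n * rnorm (iter n U x) <= e * rnorm x) ->
  forall y, s ^+ n * rnorm (iter n U y) <= rnorm y.
Proof.
move=> n0 /andP[t0 tr] /andP[s0 sr] st ce tU y.
have [w wn] : exists w : R[i], n.-primitive_root w.
  by apply: exists_prim_root; rewrite pnatr_eq0 -lt0n.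
have zn (a : R) x : 0 <= a ->
    rnorm (a%:C ^+ n *: iter n U x) = a ^+ n * rnorm (iter n U x).
  by move=> a0; rewrite rnormZ rnormX rnorm_real.
set x := y - s%:C ^+ n *: iter n U y.
have sx : root_average n w s%:C x = y by exact: root_average_inverse.
have tx : root_average n w t%:C x - x = root_average n w t%:C (t%:C ^+ n *: iter n U x).
  rewrite -[X in _ - X](root_average_inverse _ _ t%:C x wn) (root_averageB n w t%:C x).
  by rewrite opprB addrC subrK.
have h1 : rnorm (root_average n w t%:C x - x) <= 8^-1 * rnorm x.
  rewrite tx; apply: le_trans (root_average_bound _ _ _ _ wn _) _; rewrite ?rnorm_real //.
  rewrite zn //; apply: le_trans (ler_wpM2l c_ge0 (tU x)) _.
  by rewrite mulrA ler_wpM2r ?rnorm_ge0.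
have h2 : rnorm (root_average n w s%:C x - root_average n w t%:C x) <= 8^-1 * rnorm x.
  apply: le_trans (root_average_lipschitz _ _ _ _ _ wn _ _) _; rewrite ?rnorm_real //.
  by rewrite -rmorphB rnorm_complexR ler_wpM2r ?rnorm_ge0.
have h3 : rnorm (y - x) <= 8^-1 * rnorm x + 8^-1 * rnorm x.
  rewrite -[in y - x]sx -(subrK (root_average n w t%:C x) (root_average n w s%:C x)).
  by rewrite -addrA; apply: le_trans (rnormD _ _ _) (lerD h2 h1).
have yx : y - x = s%:C ^+ n *: iter n U y by rewrite /x opprB addrC subrK.
have h4 : rnorm x <= rnorm y + rnorm (y - x).
  by have := rnormB _ y (y - x); rewrite opprB addrC subrK.
rewrite -zn // -yx; have := rnorm_ge0 _ y; lra.
Qed.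

End Resolvent.

(** * Operators with spectrum {0} are quasinilpotent at every vector *)

Section SpectralRadius.
Context {R : realType} {X : completeNormedModType R[i]}.
Implicit Types U : {linear X -> X}.

(** Convergence of [t^n U^n] to 0 in operator norm: the threshold on [n] is
    uniform in [x]. *)
Definition power_decay U (t : R) : Prop :=
  forall e : R, 0 < e ->
    \forall n \near \oo, forall x, t ^+ n * rnorm (iter n U x) <= e * rnorm x.

Lemma power_decay_le U (t t' : R) :
  0 <= t' <= t -> power_decay U t -> power_decay U t'.
Proof.
move=> /andP[t0 tt'] Ut e e0; near=> n => x.
apply: (@le_trans _ _ (t ^+ n * rnorm (iter n U x))).
  by rewrite ler_wpM2r ?rnorm_ge0 // lerXn2r // nnegrE (le_trans t0).
by move: x; near: n; exact: Ut.
Unshelve. all: by end_near. Qed.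

(** Boundedness at [t + d] gives decay at the smaller [t + d / 2]; the step [d]
    depends on the resolvent bound [c] on the whole disc and not on [t]. *)
Lemma power_decay_step U u (G : R[i] -> {linear X -> X}) (r c t d : R) :
  0 <= u -> (forall x, rnorm (U x) <= u * rnorm x) ->
  (forall z x, G z (x - z *: U x) = x) ->
  (forall z x, G z x - z *: U (G z x) = x) ->
  0 <= c -> (forall z, rnorm z <= r -> forall x, rnorm (G z x) <= c * rnorm x) ->
  0 <= t -> 0 < d -> t + d <= r -> d * (c ^+ 2 * u) <= 8^-1 ->
  power_decay U t -> power_decay U (t + d / 2).
Proof.
move=> u0 Uu GK KG c0 Gc t0 d0 tdr dc Ut e e0.
pose e' := (8 * (c + 1))^-1.
have e'0 : 0 < e' by rewrite invr_gt0 mulr_gt0 // ltr_wpDl.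
have ce' : c * e' <= 8^-1.
  rewrite /e' invfM mulrCA ger_pMr // ler_pdivrMr ?ltr_wpDl // mul1r.
  by rewrite lerDl.
have td0 : 0 < t + d by rewrite ltr_wpDl.
pose q := (t + d / 2) / (t + d).
have q0 : 0 <= q by rewrite divr_ge0 // ?addr_ge0 ?divr_ge0 // ltW.
have q1 : q < 1 by rewrite /q ltr_pdivrMr // mul1r; lra.
near=> n => x.
have n0 : (0 < n)%N by near: n; exact: nbhs_infty_gt.
have qn : q ^+ n <= e.
  rewrite -[q ^+ n]ger0_norm ?exprn_ge0 //; near: n.
  have q1' : `|q| < 1 by rewrite ger0_norm.
  by have /cvgr0Pnorm_le := cvg_expr q1'; apply.
have tn : forall x, t ^+ n * rnorm (iter n U x) <= e' * rnorm x.
  by near: n; exact: Ut.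
have sn : (t + d) ^+ n * rnorm (iter n U x) <= rnorm x.
  apply: (@power_bound_transfer R X U u u0 Uu G GK KG r c c0 Gc n t (t + d) e') => //.
  - by rewrite t0 /= (le_trans _ tdr) // lerDl ltW.
  - by rewrite tdr ltW.
  - by rewrite addrC addKr gtr0_norm.
have -> : t + d / 2 = q * (t + d) by rewrite /q mulfVK ?gt_eqF.
rewrite exprMn -mulrA; apply: ler_pM => //; first exact: exprn_ge0.
by rewrite mulr_ge0 ?rnorm_ge0 // exprn_ge0 // ltW.
Unshelve. all: by end_near. Qed.

(** In terms of [1 - z U] instead of [l - U], so that [z = 0] is included and
    the resolvent is an entire function of [z]. *)
Lemma quasinilpotent_resolvent U (z : R[i]) : quasinilpotent U ->
  exists S : {linear X -> X},
  [/\ exists2 c : R, 0 <= c & forall x, rnorm (S x) <= c * rnorm x,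
      forall x, S (x - z *: U x) = x &
      forall x, S x - z *: U (S x) = x].
Proof.
move=> [_ sU]; have [->|z0] := eqVneq z 0.
  exists idfun; split=> [|x|x] /=; rewrite ?scale0r ?subr0 //.
  by exists 1 => // x; rewrite mul1r.
have [S [bS KS SK]] : exists S : {linear X -> X}, [/\ bounded_operator S,
    cancel S (scalar_sub z^-1 U) & cancel (scalar_sub z^-1 U) S].
  apply: contrapT => nS; have : spectrum U z^-1 by [].
  by rewrite sU /= => /eqP; rewrite invr_eq0 (negPf z0).
have /bounded_rnormP[c c0 Sc] := bS.
exists (z^-1 \*: S); split=> [|x|x] /=.
- exists (rnorm z^-1 * c); first by rewrite mulr_ge0 ?rnorm_ge0.
  by move=> x; rewrite rnormZ -mulrA ler_wpM2l ?rnorm_ge0.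
- rewrite -linearZ_LR scalerBr scalerA mulVf // scale1r.
  exact: SK.
- rewrite (linearZ_LR U) scalerA mulfV // scale1r.
  exact: KS.
Qed.

(** Steps of length [d / 2], starting from 0 and stopped at [t].  The resolvent
    is controlled on radius [t + 1] to leave room for the last step. *)
Lemma quasinilpotent_power_decay U (t : R) :
  quasinilpotent U -> 0 <= t -> power_decay U t.
Proof.
move=> qU t0.
have [G HG] := choice (fun z => quasinilpotent_resolvent U z qU).
have GK z x : G z (x - z *: U x) = x by case: (HG z).
have KG z x : G z x - z *: U (G z x) = x by case: (HG z).
have /bounded_rnormP[u u0 Uu] := qU.1.
have [|c c0 Hc] := @lower_bound_disc R X U u u0 Uu (t + 1).
  move=> z; have [[c c0 Gc] _ _] := HG z; exists c => // x.
  by rewrite -{1}(GK z x).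
have Gc z : rnorm z <= t + 1 -> forall x, rnorm (G z x) <= c * rnorm x.
  by move=> /Hc {}Hc x; rewrite -{2}(KG z x).
pose k0 := 8 * (c ^+ 2 * u + 1).
have cu0 : 0 <= c ^+ 2 * u by rewrite mulr_ge0 ?exprn_ge0.
have k00 : 0 < k0 by rewrite mulr_gt0 // ltr_wpDl.
pose d := k0^-1.
have d0 : 0 < d by rewrite invr_gt0.
have d1 : d <= 1 by rewrite invf_le1 // /k0; lra.
have dc : d * (c ^+ 2 * u) <= 8^-1.
  by rewrite /d mulrC ler_pdivrMr // /k0; lra.
have main k : power_decay U (Num.min t (k%:R * (d / 2))).
  elim: k => [|k IH].
    rewrite mul0r (min_idPr t0) => e e0; near=> n => x.
    have n0 : (0 < n)%N by near: n; exact: nbhs_infty_gt.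
    by rewrite expr0n gtn_eqF //= mul0r mulr_ge0 ?rnorm_ge0 // ltW.
  have m0 : 0 <= Num.min t (k%:R * (d / 2)).
    by rewrite le_min t0 mulr_ge0 // divr_ge0 // ltW.
  have := power_decay_step U u G (t + 1) c _ d u0 Uu GK KG c0 Gc m0 d0 _ dc IH.
  rewrite lerD // ?ge_min ?lexx // => /(_ isT); apply: power_decay_le.
  rewrite le_min t0 mulr_ge0 //=; last by rewrite divr_ge0 // ltW.
  have -> : k.+1%:R * (d / 2) = k%:R * (d / 2) + d / 2.
    by rewrite -addn1 natrD mulrDl mul1r.
  by rewrite addr_minl le_min !ge_min lexx orbT andbT lerDl divr_ge0 // ltW.
have h0 : 0 < d / 2 by rewrite divr_gt0.
have := main (Num.Def.archi_bound (t / (d / 2))).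
rewrite (min_idPl _) // -ler_pdivrMr // ltW // archi_boundP //.
by rewrite divr_ge0 // ltW.
Unshelve. all: by end_near. Qed.

Lemma quasinilpotent_partT U x : quasinilpotent U -> quasinilpotent_part U x.
Proof.
move=> qU; apply/quasinilpotent_partP => e e0.
have e0' : 0 <= e^-1 by rewrite invr_ge0 ltW.
have x0 : 0 < rnorm x + 1 by rewrite ltr_wpDl // rnorm_ge0.
have x0' : 0 < (rnorm x + 1)^-1 by rewrite invr_gt0.
near=> n.
have H y : e^-1 ^+ n * rnorm (iter n U y) <= (rnorm x + 1)^-1 * rnorm y.
  by move: y; near: n; exact: (quasinilpotent_power_decay U e^-1 qU e0').
move: (H x); rewrite exprVn ler_pdivrMl ?exprn_gt0 // => /le_trans; apply.
by rewrite ger_pMr ?exprn_gt0 // ler_pdivrMl // mulr1 lerDl.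
Unshelve. all: by end_near. Qed.

End SpectralRadius.

(** * Comparison of an operator with its generalized Drazin inverse *)

Section Transfer.
Context {R : realType} {X : completeNormedModType R[i]}.
Implicit Types A B : {linear X -> X}.

Lemma iter_commute (f g : X -> X) : (forall x, f (g x) = g (f x)) ->
  forall n x, iter n f (g x) = g (iter n f x).
Proof. by move=> fg; elim=> [|n IH] x //; rewrite !iterS IH fg. Qed.

(** For [Q] an idempotent commuting with [A] this says that the [Q]-component of
    the quasinilpotent part is trivial when [A] has a bounded left inverse on
    the range of [Q]: iterating, [|Q x| <= k^n |Q A^n x|]. *)
Lemma quasinilpotent_part_vanish A (Q C : X -> X) (q k : R) x :
  0 <= q -> (forall x, rnorm (Q x) <= q * rnorm x) ->
  0 <= k -> (forall x, rnorm (C x) <= k * rnorm x) ->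
  (forall x, A (Q x) = Q (A x)) -> (forall x, C (A (Q x)) = Q x) ->
  quasinilpotent_part A x -> Q x = 0.
Proof.
move=> q0 Qq k0 Ck AQ CAQ.
apply: (@quasinilpotent_part_dominated0 R X A x (Q x) q k) => // n.
elim: n x => [|n IH] x; first by rewrite expr0 mulr1 Qq.
rewrite -CAQ; apply: le_trans (Ck _) _.
rewrite AQ exprS iterSr mulrCA -mulrA.
exact: (ler_wpM2l k0 (IH (A x))).
Qed.

(** On a subset invariant under [A], if [B = C A] with [C] bounded and commuting
    with [B], then [B^n = C^n A^n] there. *)
Lemma quasinilpotent_part_transfer A B (C : X -> X) (F : set X) (k : R) x :
  0 <= k -> (forall x, rnorm (C x) <= k * rnorm x) ->
  (forall x, F x -> F (A x)) -> (forall x, B (C x) = C (B x)) ->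
  (forall x, F x -> B x = C (A x)) ->
  F x -> quasinilpotent_part A x -> quasinilpotent_part B x.
Proof.
move=> k0 Ck FA BC BCA Fx Ax; apply/quasinilpotent_partP.
apply: (@quasinilpotent_part_dominated R X A x _ 1 k) => // n.
rewrite mul1r; elim: n x Fx {Ax} => [|n IH] x Fx; first by rewrite expr0 mul1r.
rewrite iterSr BCA // iter_commute //; apply: le_trans (Ck _) _.
rewrite exprS iterSr -mulrA.
exact: (ler_wpM2l k0 (IH _ (FA _ Fx))).
Qed.

Lemma closed_kernel A : bounded_operator A -> closed [set x | A x = 0].
Proof.
move=> /linear_bounded_continuous/continuous_closedP/(_ [set 0]); apply.
exact: (accessible_closed_set1 (hausdorff_accessible (@norm_hausdorff _ X))).
Qed.

Variables T S : {linear X -> X}.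
Hypotheses (bT : bounded_operator T) (gTS : is_gDrazin_inverse T S).

Let bS : bounded_operator S. Proof. by case: gTS. Qed.
Let SC x : S (T x) = T (S x). Proof. by case: gTS => _ h _ _; exact: h. Qed.
Let TSS x : T (S (S x)) = S x.
Proof. by rewrite -SC; case: gTS => _ _ h _; exact: h. Qed.

(** The spectral idempotent of [T] at 0. *)
Let P (x : X) : X := x - T (S x).

(** A single constant for all the operators involved spares keeping track of
    which bound is used where. *)
Lemma common_bound : exists2 k : R, 0 <= k &
  [/\ forall x, rnorm (T x) <= k * rnorm x, forall x, rnorm (S x) <= k * rnorm x,
   forall x, rnorm (T (S x)) <= k * rnorm x & forall x, rnorm (P x) <= k * rnorm x].
Proof.
have /bounded_rnormP[t t0 Tt] := bT; have /bounded_rnormP[s s0 Ss] := bS.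
have TSx x : rnorm (T (S x)) <= t * s * rnorm x.
  by apply: le_trans (Tt _) _; rewrite -mulrA; exact: (ler_wpM2l t0 (Ss x)).
have ts0 : 0 <= t * s by rewrite mulr_ge0.
have up a (x : X) : a <= 1 + t + s + t * s -> a * rnorm x <= (1 + t + s + t * s) * rnorm x.
  by move=> ?; rewrite ler_wpM2r ?rnorm_ge0.
exists (1 + t + s + t * s); first by lra.
split=> x.
- by apply: le_trans (Tt x) (up _ _ _); lra.
- by apply: le_trans (Ss x) (up _ _ _); lra.
- by apply: le_trans (TSx x) (up _ _ _); lra.
- apply: le_trans (rnormB _ _ _) _; apply: le_trans (up (1 + t * s) x _); last by lra.
  by rewrite mulrDl mul1r lerD2l.
Qed.

(** On the range of [T S], [- S] is a bounded left inverse of [- T]; on [ker S],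
    [- T] coincides with the quasinilpotent operator [U = T S T - T]. *)
Lemma quasinilpotent_part0 x : quasinilpotent_part (scalar_sub 0 T) x <-> S x = 0.
Proof.
have [k k0 [Tk Sk TSk _]] := common_bound; split.
  move=> Hx; rewrite -TSS -SC.
  rewrite (_ : T (S x) = 0) ?linear0 //.
  apply: (@quasinilpotent_part_vanish (scalar_sub 0 T) (T \o S) (\- S) k k) Hx => //= y.
  - by rewrite rnormN.
  - by rewrite !scale0r !sub0r !linearN /= SC.
  - by rewrite scale0r sub0r linearN opprK SC SC TSS.
move=> Sx; have [_ _ _ [U [qU TU]]] := gTS.
have UE y : S y = 0 -> U y = - T y.
  move=> Sy; have /= := TU y; rewrite SC Sy !linear0 => /eqP.
  by rewrite eq_sym addrC addr_eq0 => /eqP.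
apply: (@quasinilpotent_part_transfer U (scalar_sub 0 T) idfun [set y | S y = 0] 1) => //=.
- by move=> y; rewrite mul1r.
- by move=> y Sy; rewrite UE // linearN SC Sy linear0 oppr0.
- by move=> y Sy; rewrite UE // scale0r sub0r.
- exact: quasinilpotent_partT.
Qed.

(** On the range of [T S], [- T] is a bounded left inverse of [- S]; on [ker S]
    the iterates of [- S] vanish from the first one on. *)
Lemma quasinilpotent_part0D x : quasinilpotent_part (scalar_sub 0 S) x <-> S x = 0.
Proof.
have [k k0 [Tk Sk TSk _]] := common_bound; split.
  move=> Hx; rewrite -TSS -SC.
  rewrite (_ : T (S x) = 0) ?linear0 //.
  apply: (@quasinilpotent_part_vanish (scalar_sub 0 S) (T \o S) (\- T) k k) Hx => //= y.
  - by rewrite rnormN.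
  - by rewrite !scale0r !sub0r !linearN /= SC.
  - by rewrite scale0r sub0r linearN opprK SC TSS.
move=> Sx; apply/quasinilpotent_partP => e e0; near=> n.
have n0 : (0 < n)%N by near: n; exact: nbhs_infty_gt.
rewrite -(prednK n0) iterSr /= Sx scale0r subr0.
rewrite (_ : iter _ _ _ = 0) ?rnorm0 ?exprn_ge0 ?ltW //.
by elim: (n.-1) => //= m ->; rewrite scaler0 linear0 subr0.
Unshelve. all: by end_near. Qed.

(** In each direction, [P x = 0] is established first, and then the iterates are
    compared on [ker P], where [l^-1 - S = - l^-1 S (l - T)] and, symmetrically,
    [l - T = - l T (l^-1 - S)]. *)
Lemma quasinilpotent_part_inv (l : R[i]) x : l != 0 ->
  quasinilpotent_part (scalar_sub l T) x <->
  quasinilpotent_part (scalar_sub l^-1 S) x.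
Proof.
move=> l0; have [k k0 [Tk Sk TSk Pk]] := common_bound.
have fixed y : P y = 0 -> T (S y) = y by move/eqP; rewrite subr_eq0 => /eqP.
have SP y : S (P y) = 0 by rewrite linearB SC TSS subrr.
have TP y : T (P y) = P (T y) by rewrite /P linearB SC.
have PS y : P (S y) = 0 by rewrite /P TSS subrr.
have PZ m y : m *: P y = P (m *: y) by rewrite /P (linearZ_LR S) (linearZ_LR T) scalerBr.
have PB y z : P (y - z) = P y - P z.
  rewrite /P (linearB S) (linearB T) !opprB addrACA [RHS]addrACA.
  by rewrite [- z - _]addrC.
have PL m y : scalar_sub m T (P y) = P (scalar_sub m T y).
  by rewrite /= TP PZ PB.
have PM m y : scalar_sub m S (P y) = P (scalar_sub m S y).
  by rewrite /= SP PZ PB PS.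
have [_ _ _ [U [qU TU]]] := gTS.
have UP y : U (P y) = - T (P y).
  have /= := TU (P y); rewrite SC SP !linear0 => /eqP.
  by rewrite eq_sym addrC addr_eq0 => /eqP.
split=> Hx.
  have Px : P x = 0.
    (* On [ran P], [l - T = l + U] is inverted by [l^-1 (1 + l^-1 U)^-1]. *)
    have [G [[g g0 Gg] GK _]] := quasinilpotent_resolvent U (- l^-1) qU.
    apply: (@quasinilpotent_part_vanish (scalar_sub l T) P
      (fun y => G (l^-1 *: y)) k (g * rnorm l^-1)) Hx => //.
    - by rewrite mulr_ge0 ?rnorm_ge0.
    - by move=> y; apply: le_trans (Gg _) _; rewrite rnormZ mulrA.
    - move=> y /=; rewrite -[RHS]GK UP scalerN scaleNr opprK.
      by rewrite scalerBr scalerA mulVf // scale1r.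
  apply: (@quasinilpotent_part_transfer (scalar_sub l T) (scalar_sub l^-1 S)
    (fun y => - l^-1 *: S y) [set y | T (S y) = y] (rnorm l^-1 * k)) Hx => /=.
  - by rewrite mulr_ge0 ?rnorm_ge0.
  - by move=> y; rewrite rnormZ rnormN -mulrA (ler_wpM2l (rnorm_ge0 _ _) (Sk y)).
  - by move=> y Fy; rewrite !(linearB S) !(linearB T) (linearZ_LR S) (linearZ_LR T) Fy SC Fy.
  - by move=> y; rewrite (linearB S) !(linearZ_LR S) scalerBr !scalerA mulrC.
  - move=> y Fy; rewrite (linearB S) (linearZ_LR S) SC Fy scalerBr scalerA mulNr mulVf //.
    by rewrite scaleN1r scaleNr opprK addrC.
  - exact: fixed.
(* On [ran P], [l^-1 - S] is the scalar [l^-1]. *)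
have Px : P x = 0.
  apply: (@quasinilpotent_part_vanish (scalar_sub l^-1 S) P
    (fun y => l *: y) k (rnorm l)) Hx => //.
  - exact: rnorm_ge0.
  - by move=> y; rewrite rnormZ.
  - by move=> y /=; rewrite SP subr0 scalerA mulfV // scale1r.
apply: (@quasinilpotent_part_transfer (scalar_sub l^-1 S) (scalar_sub l T)
  (fun y => - l *: T y) [set y | T (S y) = y] (rnorm l * k)) Hx => /=.
- by rewrite mulr_ge0 ?rnorm_ge0.
- by move=> y; rewrite rnormZ rnormN -mulrA (ler_wpM2l (rnorm_ge0 _ _) (Tk y)).
- by move=> y Fy; rewrite !(linearB S) !(linearB T) (linearZ_LR S) (linearZ_LR T) Fy TSS.
- by move=> y; rewrite (linearB T) !(linearZ_LR T) scalerBr !scalerA mulrC.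
- move=> y Fy; rewrite (linearB T) (linearZ_LR T) Fy scalerBr scalerA mulNr mulfV //.
  by rewrite scaleN1r scaleNr opprK addrC.
- exact: fixed.
Qed.

End Transfer.

Theorem corollary4p7 (R : realType) (X : completeNormedModType R[i])
    (hX : infinite_dimensional X)
    (T : {linear X -> X}) (hT : bounded_operator T)
    (TD : {linear X -> X}) (hTD : is_gDrazin_inverse T TD) :
  property_Q T <-> property_Q TD.
Proof.
have bTD : bounded_operator TD by case: hTD.
have Q0 : closed (quasinilpotent_part (scalar_sub 0 T)).
  have -> : quasinilpotent_part (scalar_sub 0 T) = [set x | TD x = 0].
    by apply/seteqP; split=> x /(quasinilpotent_part0 T TD hT hTD).
  exact: closed_kernel.
have Q0D : closed (quasinilpotent_part (scalar_sub 0 TD)).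
  have -> : quasinilpotent_part (scalar_sub 0 TD) = [set x | TD x = 0].
    by apply/seteqP; split=> x /(quasinilpotent_part0D T TD hT hTD).
  exact: closed_kernel.
have Qinv l : l != 0 -> quasinilpotent_part (scalar_sub l T) =
    quasinilpotent_part (scalar_sub l^-1 TD).
  move=> l0; apply/seteqP.
  by split=> x /(quasinilpotent_part_inv T TD hT hTD l x l0).
split=> Q l; have [->//|l0] := eqVneq l 0.
  by rewrite -[l]invrK -Qinv ?invr_eq0.
by rewrite Qinv.
Qed.
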